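(* Let $q$ be a prime power. If there is a strongly regular $q$-ary graph with parameters $(v,k,\lambda,\mu;q)$, then $$\left([k+1]_q-1\right)\left([k+1]_q-2-\lambda\right)=\left([v]_q-[k+1]_q\right)\mu .$$
   Context: For an integer $a\ge 0$, $[a]_q=\sum_{i=0}^{a-1}q^i=\frac{q^a-1}{q-1}$, which is the number of $1$-dimensional subspaces of $\mathbb{F}_q^a$. A $q$-ary graph with underlying vector space $W$ over $\mathbb{F}_q$ is a pair $\mathcal{E}=(V,E)$ where $V$ is the set of all $1$-dimensional subspaces of $W$ (the vertices) and $E$ is a set of $2$-dimensional subspaces of $W$ (the edges). Two vertices $X,Y$ are adjacent if the span $\langle X,Y\rangle$ is an element of $E$ (in particular $X\neq Y$). The neighborhood $N_{\mathcal{E}}(X)$ of a vertex $X$ is the set consisting of $X$ and all vertices adjacent to $X$. A set of $1$-dimensional subspaces is identified with a subspace $U$ when it is exactly the set of all $1$-dimensional subspaces of $U$. Let $v\ge 1$ and $k\ge 0$ be integers. A $q$-ary graph $\mathcal{E}$ with underlying vector space $\mathbb{F}_q^v$ is $k$-regular if for every vertex $X$ the neighborhood $N_{\mathcal{E}}(X)$ is a $(k+1)$-dimensional subspace of $\mathbb{F}_q^v$. A $k$-regular $q$-ary graph $\mathcal{E}$ with underlying vector space $\mathbb{F}_q^v$ is a strongly regular $q$-ary graph with parameters $(v,k,\lambda,\mu;q)$ ($\lambda,\mu$ integers) if for all vertices $X\ne Y$ the number of vertices in $(N_{\mathcal{E}}(X)\cap N_{\mathcal{E}}(Y))\setminus\{X,Y\}$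 equals $\lambda$ if $X$ and $Y$ are adjacent, and equals $\mu$ otherwise. If no adjacent (resp. no non-adjacent) pairs of distinct vertices exist, the condition on $\lambda$ (resp. $\mu$) is vacuous and that parameter is arbitrary. *)

(* Defs.v *)
From HB Require Import structures.
From mathcomp Require Import all_boot all_order all_algebra.

Set Implicit Arguments.
Unset Strict Implicit.
Unset Printing Implicit Defensive.

Import GRing.Theory.

(* {vspace W} is a subtype of the square matrices over F, hence finite. *)
HB.instance Definition _ (F : finFieldType) (W : vectType F) :=
  isCountable.Build {vspace W}
    (pcan_pickleK (can_pcan (@VectorInternalTheory.vs2mxK F W))).
HB.instance Definition _ (F : finFieldType) (W : vectType F) :=
  isFinite.Build {vspace W}
    (pcan_enumP (can_pcan (@VectorInternalTheory.vs2mxK F W))).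

Definition prime_power (q : nat) : Prop :=
  exists p n : nat, [/\ prime p, 0 < n & q = p ^ n].

Definition qnumber (q a : nat) : nat := \sum_(i < a) q ^ i.

Section QGraph.

Variables (F : finFieldType) (W : vectType F).

Definition vertex : predArgType := {X : {vspace W} | \dim X == 1}.

Record qgraph := QGraph {
  edges : {set {vspace W}};
  edges_dim : forall U, U \in edges -> \dim U = 2
}.

(* Implies X != Y, since <X, X> = X has dimension 1. *)
Definition adjacent (G : qgraph) (X Y : vertex) : bool :=
  (val X + val Y)%VS \in edges G.

Definition neighborhood (G : qgraph) (X : vertex) : {set vertex} :=
  X |: [set Y | adjacent G X Y].

Definition points (U : {vspace W}) : {set vertex} :=
  [set X : vertex | (val X <= U)%VS].

Definition regular (G : qgraph) (k : nat) : Prop :=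
  forall X : vertex,
    exists2 U : {vspace W}, \dim U = k.+1 & neighborhood G X = points U.

Definition strongly_regular (G : qgraph) (k : nat) (lambda mu : int) : Prop :=
  regular G k /\
  forall X Y : vertex, X != Y ->
    #|(neighborhood G X :&: neighborhood G Y) :\: [set X; Y]|%:Z%R =
      if adjacent G X Y then lambda else mu.

End QGraph.

(* Main.v *)
Require Import Defs.
From mathcomp Require Import all_boot all_order all_algebra.
From mathcomp Require Import finfield.

(** The identity is the double count known from ordinary strongly regular
graphs: a q-ary graph gives a symmetric adjacency relation on the points of
the projective space of [W], and regularity makes every closed neighborhood
the point set of a (k+1)-dimensional subspace.

Fix a vertex X and count the pairs (Y, Z) such that Y is a neighbor of X and Z
is a neighbor of Y outside the closed neighborhood N(X).  Each of the
[k+1]_q - 1 neighbors Y sees [k+1]_q - 2 - lambda such Z, because N(X) and N(Y)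
share X, Y and lambda further vertices.  Each of the [v]_q - [k+1]_q vertices Z
outside N(X) is reached through mu vertices Y.  The equality of the two counts,
[double_count], holds in every q-ary graph; the degrees and the number of
vertices come from [card_points], the number of points of a subspace. *)

Import GRing.Theory.

Section PointCount.

Set Implicit Arguments.
Unset Strict Implicit.

Variables (F : finFieldType) (W : vectType F).

Lemma card_vspace_vectors (V : {vspace W}) :
  #|[pred x : finvect_type W | x \in V]| = #|F| ^ \dim V.
Proof.
(* The statement of [card_vspace] packs the vector space from its class; as
   records have no definitional eta, [W] has to be taken apart to match it. *)
case: W V => T c V.
by rewrite -(@card_vspace F (finvect_type (Vector.Pack c)) c V); apply: eq_card.
Qed.

Lemma mem_vertexE (x : W) (X : vertex W) :
  x != 0%R -> (x \in val X) = (val X == <[x]>%VS).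
Proof.
move=> x0; apply/idP/eqP => [xX|->]; last by rewrite memv_line.
by apply/esym/eqP; rewrite eqEdim -memvE xX dim_vline x0 (eqP (valP X)).
Qed.

(** Every nonzero vector of [U] spans exactly one point of [U], and every point
contains [#|F|.-1] nonzero vectors: both sides count the incident pairs of a
point of [U] and a nonzero vector. *)
Lemma predn_card_points (U : {vspace W}) :
  (#|F|.-1 * #|points U| = (#|F| ^ \dim U).-1)%N.
Proof.
pose fW := finvect_type W.
have card_nz (V : {vspace W}) :
    #|[pred x : fW | (x != 0%R) && (x \in V)]| = (#|F| ^ \dim V).-1.
  rewrite -card_vspace_vectors [in RHS](cardD1 (0%R : fW)) inE.
  rewrite (mem0v V : (_ : fW) \in V) /=.
  by apply: eq_card => x; rewrite !inE.
(* Reading the exponent 1 of [#|F| ^ 1] as the dimension of the point X turns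
   [#|F|.-1] into the number of nonzero vectors of X. *)
rewrite mulnC -sum_nat_const -card_nz -[RHS]sum1_card.
under eq_bigr => X _.
  rewrite -[X in X.-1](expn1 #|F|) -(eqP (valP X)) -card_nz -sum1_card. over.
rewrite (exchange_big_dep [pred x : fW | (x != 0%R) && (x \in U)]) /=;
  last first.
  by move=> X x; rewrite !inE => XU /andP[-> xX] /=; exact: subvP XU _ xX.
apply: eq_bigr => x /andP[x0 xU].
have xdim : \dim <[x : W]>%VS == 1 by rewrite dim_vline (x0 : (x : W) != 0%R).
rewrite (big_pred1 (Sub <[x : W]>%VS xdim : vertex W)) // => X.
rewrite in_set inE [x != _]x0 mem_vertexE //.
apply/andP/eqP => [[_ /eqP XE]|->]; first exact: val_inj.
by rewrite /= eqxx -memvE.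
Qed.

Lemma card_points (U : {vspace W}) : #|points U| = qnumber #|F| (\dim U).
Proof.
have F1 : 0 < #|F|.-1 by rewrite -subn1 subn_gt0 finNzRing_gt1.
by apply/eqP; rewrite -(eqn_pmul2l F1) predn_card_points predn_exp.
Qed.

Lemma card_vertex : #|vertex W| = qnumber #|F| (\dim {:W}).
Proof.
by rewrite -card_points -cardsT; apply: eq_card => X; rewrite !inE subvf.
Qed.

Lemma vertex_exists : 0 < \dim {:W} -> vertex W.
Proof.
move=> W0; exists <[vpick {:W}]>%VS.
by rewrite dim_vline vpick0 -dimv_eq0 -lt0n W0.
Qed.

End PointCount.

Section Neighborhoods.

Set Implicit Arguments.
Unset Strict Implicit.

Variables (F : finFieldType) (W : vectType F) (G : qgraph W).

Lemma adjacent_sym (X Y : vertex W) : adjacent G X Y = adjacent G Y X.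
Proof. by rewrite /adjacent addvC. Qed.

Lemma neighborhood_refl (X : vertex W) : X \in neighborhood G X.
Proof. by rewrite !inE eqxx. Qed.

Lemma neighborhood_sym (X Y : vertex W) :
  (X \in neighborhood G Y) = (Y \in neighborhood G X).
Proof. by rewrite !inE eq_sym adjacent_sym. Qed.

(** Both sides count the paths X, Y, Z with Y a neighbor of X and Z outside the
closed neighborhood of X, grouped by Y on the left and by Z on the right.  Such
a Z is neither X nor adjacent to X, so Y differs from Z and no path is lost by
removing X and Z on the right. *)
Lemma double_count (X : vertex W) :
  \sum_(Y in neighborhood G X :\ X) #|neighborhood G Y :\: neighborhood G X|
  = \sum_(Z in ~: neighborhood G X)
      #|(neighborhood G X :&: neighborhood G Z) :\: [set X; Z]|.
Proof.
under eq_bigr do rewrite -sum1_card.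
under [RHS]eq_bigr do rewrite -sum1_card.
rewrite (exchange_big_dep (mem (~: neighborhood G X))) /=; last first.
  by move=> Y Z _; rewrite in_setD in_setC => /andP[].
apply: eq_bigr => Z; rewrite in_setC => ZX; apply: eq_bigl => Y.
rewrite !(in_setD, in_setI, in_set1, in_set2) ZX (neighborhood_sym Z) negb_or.
case: (Y =P Z) => [->|_]; first by rewrite (negPf ZX) !andbF.
by rewrite andbT -andbA.
Qed.

Lemma card_neighborhood (k : nat) (X : vertex W) :
  regular G k -> #|neighborhood G X| = qnumber #|F| k.+1.
Proof. by case/(_ X) => U dimU ->; rewrite card_points dimU. Qed.

(** For adjacent X and Y the closed neighborhoods contain both X and Y: this is
the 2 subtracted in the formula. *)
Lemma card_neighborhood_split (X Y : vertex W) :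
    X != Y -> adjacent G X Y ->
  #|neighborhood G Y|
  = #|(neighborhood G X :&: neighborhood G Y) :\: [set X; Y]| + 2
    + #|neighborhood G Y :\: neighborhood G X|.
Proof.
move=> XY adjXY; rewrite -(cardsID (neighborhood G X)); congr (_ + _)%N.
have sub : [set X; Y] \subset neighborhood G X :&: neighborhood G Y.
  rewrite subUset !sub1set !in_setI !neighborhood_refl neighborhood_sym /= andbT.
  by rewrite andbb !inE adjXY orbT.
rewrite setIC -(cardsID [set X; Y]) (setIidPr sub) cards2 XY.
by rewrite addnC.
Qed.

End Neighborhoods.

Local Open Scope ring_scope.

Theorem theorem3p9 (q : nat) (hq : prime_power q)
    (F : finFieldType) (hF : #|F| = q)
    (v k : nat) (hv : (1 <= v)%N) (lambda mu : int) :
  (exists G : qgraph 'rV[F]_v, strongly_regular G k lambda mu) ->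
  ((qnumber q k.+1)%:Z - 1) * ((qnumber q k.+1)%:Z - 2 - lambda) =
  ((qnumber q v)%:Z - (qnumber q k.+1)%:Z) * mu.
Proof.
case=> G [regG srG].
have dimW : \dim {: 'rV[F]_v} = v by rewrite dimvf /dim /= mul1n.
have X : vertex 'rV[F]_v by apply: vertex_exists; rewrite dimW.
set N := neighborhood G X.
have cardN Y : #|neighborhood G Y| = qnumber q k.+1.
  by rewrite (card_neighborhood _ regG) hF.
have cardNX : (#|N :\ X|%:Z = (qnumber q k.+1)%:Z - 1)%R.
  have XN : X \in N := neighborhood_refl G X.
  by rewrite -(cardN X) -/N (cardsD1 X N) XN addnC PoszD addrK.
have cardNC : (#|~: N|%:Z = (qnumber q v)%:Z - (qnumber q k.+1)%:Z)%R.
  have -> : qnumber q v = #|vertex 'rV[F]_v| by rewrite card_vertex dimW hF.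
  by rewrite -(cardN X) -(cardsC N) PoszD addrC addKr.
have := congr1 (GRing.natmul (1 : int)) (double_count G X).
rewrite [X in X = _ -> _]natr_sum [X in _ = X -> _]natr_sum -/N.
under eq_bigr => Y.
  rewrite !inE => /andP[YX]; rewrite (negPf YX) /= => adjXY.
  have XY : X != Y by rewrite eq_sym.
  have := congr1 Posz (card_neighborhood_split XY adjXY).
  rewrite cardN !PoszD srG // adjXY -/N => e.
  have -> : (#|neighborhood G Y :\: N|%:R
      = (qnumber q k.+1)%:Z - 2 - lambda :> int)%R.
    by rewrite natz e [lambda + _ + _]addrAC addrK addrAC subrr add0r.
  over.
under [RHS]eq_bigr => Z.
  rewrite !inE negb_or => /andP[ZX nadj].
  rewrite natz srG 1?eq_sym // (negPf nadj). over.
rewrite !sumr_const -[X in X = _]mulr_natl -[X in _ = X]mulr_natl.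
by rewrite !(natz #|_|) cardNX cardNC.
Qed.
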